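(* Let $X$ be a finite simple graph and let $\ell$ be an integer with $0\le\ell\le|V(X)|$. A set $B\subseteq V(X)$ is an $\ell$-leaky PSD forcing set of $X$ if and only if $B\cap F\neq\varnothing$ for every nonempty connected set $F\subseteq V(X)$ satisfying $|\partial^{X}_1(F)|\le\ell$. Consequently, $Z^+_{(\ell)}(X)$ equals the minimum size of a set of vertices meeting every member of the family of all nonempty connected $F\subseteq V(X)$ with $|\partial^{X}_1(F)|\le\ell$.
   Context: All graphs are finite and simple. A set $F\subseteq V(X)$ is connected if the induced subgraph $X[F]$ is connected. For a nonempty connected $F\subseteq V(X)$, its singleton boundary is \[ \partial^{X}_1(F)=\{x\in V(X)\setminus F : |N_X(x)\cap F|=1\}. \] PSD color-change rule on a graph $X$: let $B\subseteq V(X)$ be the current set of blue vertices (all others are white), and let $C$ be the vertex set of a connected component of $X-B$. A blue vertex $x\in B$ may PSD-force a vertex $y\in C$ (turn $y$ blue) when $N_X(x)\cap C=\{y\}$. Forces are applied one after another, recomputing the components of the white graph after each force. A leak is a vertex that is forbidden to perform a force. A set $B\subseteq V(X)$ is an $\ell$-leaky PSD forcing set of $X$ if, for every set $L\subseteq V(X)$ of exactly $\ell$ leaks, starting from the initial blue set $B$ there is a sequence of PSD forces, none performed by a vertex of $L$, after which all vertices of $X$ are blue. $Z^+_{(\ell)}(X)$ denotes the minimum size of an $\ell$-leaky PSD forcing set of $X$. *)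

(* Defs.v *)
(* A finite simple graph is a symmetric irreflexive relation
   [e : rel V] on a finite type [V]; these two properties are hypotheses of the
   theorem rather than of the definitions. *)
From mathcomp Require Import all_boot.

Set Implicit Arguments.
Unset Strict Implicit.
Unset Printing Implicit Defensive.

Definition nbrs (V : finType) (e : rel V) (x : V) : {set V} := [set y | e x y].

Definition induced (V : finType) (e : rel V) (S : {set V}) : rel V :=
  [rel x y | [&& x \in S, y \in S & e x y]].

(* The empty set passes this test, so nonemptiness is always required apart. *)
Definition connected_set (V : finType) (e : rel V) (F : {set V}) : bool :=
  [forall x in F, forall y in F, connect (induced e F) x y].

Definition boundary1 (V : finType) (e : rel V) (F : {set V}) : {set V} :=
  [set x in ~: F | #|nbrs e x :&: F| == 1].

Definition white_components (V : finType) (e : rel V) (B : {set V}) :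
    {set {set V}} :=
  [set [set y | connect (induced e (~: B)) x y] | x in ~: B].

(* [y \in C] is implied by [nbrs e x :&: C == [set y]]. *)
Definition psd_force (V : finType) (e : rel V) (B : {set V}) (x y : V) : bool :=
  (x \in B) &&
  [exists C in white_components e B, nbrs e x :&: C == [set y]].

Definition psd_step (V : finType) (e : rel V) (L : {set V}) : rel {set V} :=
  [rel B B' | [exists x, exists y,
    [&& x \notin L, psd_force e B x y & B' == y |: B]]].

(* [connect] is the reflexive transitive closure: a finite, possibly empty,
   sequence of forces, with the white components recomputed at each step. *)
Definition leaky_psd_forcing (V : finType) (e : rel V) (l : nat) (B : {set V}) :
    bool :=
  [forall L : {set V}, (#|L| == l) ==> connect (psd_step e L) B [set: V]].

(* This is the minimum cardinality as soon as [P [set: V]] holds, which is the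
   case in both uses: see [leaky_psd_forcingT] and [hitting_setT]. *)
Definition min_size (V : finType) (P : pred {set V}) : nat :=
  #|[arg min_(B < [set: V] | P B) #|B| ]|.

Definition leaky_psd_number (V : finType) (e : rel V) (l : nat) : nat :=
  min_size (leaky_psd_forcing e l).

Definition forts (V : finType) (e : rel V) (l : nat) : {set {set V}} :=
  [set F : {set V} |
    [&& F != set0, connected_set e F & #|boundary1 e F| <= l]].

Definition hitting_set (V : finType) (Fs : {set {set V}}) (B : {set V}) :
    bool :=
  [forall F in Fs, B :&: F != set0].

Definition hitting_number (V : finType) (Fs : {set {set V}}) : nat :=
  min_size (hitting_set Fs).

Lemma leaky_psd_forcingT (V : finType) (e : rel V) (l : nat) :
  leaky_psd_forcing e l [set: V].
Proof. by apply/forallP => L; apply/implyP => _; apply: connect0. Qed.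

Lemma hitting_setT (V : finType) (e : rel V) (l : nat) :
  hitting_set (forts e l) [set: V].
Proof.
by apply/forallP => F; apply/implyP; rewrite inE setTI => /and3P[].
Qed.

(* Main.v *)
(* A leak set containing the singleton boundary of a connected white set F
   freezes F: F lies inside one white component, so a force into F can only come
   from that boundary.  Conversely, if B meets every F with a boundary of size
   at most l, then any white component has a boundary larger than l, hence a
   boundary vertex that is no leak; it is blue and can force. *)
Require Import Defs.
From mathcomp Require Import all_boot.

Set Implicit Arguments.
Unset Strict Implicit.
Unset Printing Implicit Defensive.

Lemma induced_sym (V : finType) (e : rel V) (S : {set V}) :
  symmetric e -> symmetric (induced e S).
Proof. by move=> e_sym x y; rewrite /induced /= e_sym andbCA. Qed.

Lemma connect_inducedS (V : finType) (e : rel V) (S T : {set V}) :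
  S \subset T -> subrel (connect (induced e S)) (connect (induced e T)).
Proof.
move=> /subsetP sST; apply: connect_sub => x y /and3P[xS yS exy].
by apply: connect1; rewrite /induced /= !sST.
Qed.

Lemma connect_induced_mem (V : finType) (e : rel V) (S : {set V}) (x y : V) :
  x \in S -> connect (induced e S) x y -> y \in S.
Proof.
move=> xS xy; have clS : closed (induced e S) (mem S).
  by move=> u v /and3P[/= uS vS _]; rewrite uS vS.
by rewrite -(closed_connect clS xy).
Qed.

(** Every vertex on a path from [x] inside [S] is itself reachable from [x], so the path never
    leaves the component. Any two vertices are then joined through [x], by symmetry. *)
Lemma component_connected (V : finType) (e : rel V) (S : {set V}) (x : V) :
  symmetric e -> connected_set e [set y | connect (induced e S) x y].
Proof.
move=> e_sym; set C := [set y | _].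
have xC y : y \in C -> connect (induced e C) x y.
  rewrite inE => /connectP[p].
  (* Induction from the end of the path keeps the start [x] fixed, so each prefix again starts at
     [x]. *)
  elim/last_ind: p y => [|p z IHp] y; first by move=> _ ->; apply: connect0.
  rewrite rcons_path last_rcons => /andP[xp pz] ->{y}.
  apply: connect_trans (IHp _ xp erefl) (connect1 _).
  have Cp : connect (induced e S) x (last x p) by apply/connectP; exists p.
  rewrite /induced /= !inE Cp (connect_trans Cp (connect1 pz)) /=.
  by case/and3P: pz.
apply/forallP => u; apply/implyP => uC; apply/forallP => v; apply/implyP => vC.
apply: connect_trans (xC v vC).
by rewrite (sym_connect_sym (induced_sym C e_sym)) xC.
Qed.

Lemma connected_sub_component (V : finType) (e : rel V) (B F C : {set V})
    (y : V) :
    connected_set e F -> F \subset ~: B -> C \in white_components e B ->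
  y \in F -> y \in C -> F \subset C.
Proof.
move=> /forallP Fconn FB /imsetP[x0 _ ->] yF; rewrite inE => x0y.
apply/subsetP => z zF; rewrite inE (connect_trans x0y) //.
apply: connect_inducedS FB _ _ _.
by move/implyP/(_ yF)/forallP/(_ z)/implyP: (Fconn y); apply.
Qed.

(** Leak sets have exactly [l] elements, so a smaller singleton boundary has to be padded with other
    vertices. *)
Lemma superset_of_card (V : finType) (A : {set V}) (l : nat) :
  #|A| <= l <= #|V| -> exists2 L : {set V}, A \subset L & #|L| = l.
Proof.
case/andP=> Al lV; exists (A :|: [set x in take (l - #|A|) (enum (~: A))]).
  exact: subsetUl.
rewrite cardsU disjoint_setI0 ?cards0 ?subn0; last first.
  rewrite disjoint_sym disjoints_subset; apply/subsetP => x.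
  by rewrite inE => /mem_take; rewrite mem_enum.
rewrite cardsE (card_uniqP _) ?take_uniq ?enum_uniq // size_takel ?subnKC //.
by rewrite -cardE [#|~: A|]cardsCs setCK leq_sub2r.
Qed.

Lemma psd_step_avoids (V : finType) (e : rel V) (L F B B' : {set V}) :
    connected_set e F -> boundary1 e F \subset L -> psd_step e L B B' ->
  F \subset ~: B -> F \subset ~: B'.
Proof.
move=> Fconn /subsetP FL /existsP[x /existsP[y /and3P[xL xy /eqP->]]] FB.
rewrite setCU subsetI FB andbT subsetC sub1set inE; apply/negP => yF.
case/andP: xy => xB /existsP[C /andP[Ccomp /eqP NC]].
have yNC : y \in nbrs e x :&: C by rewrite NC set11.
case/setIP: yNC => yN yC.
case/negP: xL; apply: FL; rewrite 2!inE.
have -> /= : x \notin F by apply/negP => /(subsetP FB); rewrite inE xB.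
(* Since [F] lies in the white component [C], the neighbours of [x] in [F] are among those in [C],
   that is, only [y]. *)
suff -> : nbrs e x :&: F = [set y] by rewrite cards1.
apply/eqP; rewrite eqEsubset -{1}NC setIS; last first.
  exact: connected_sub_component Fconn FB Ccomp yF yC.
by rewrite sub1set inE yN.
Qed.

Lemma leaky_psd_forcing_hits (V : finType) (e : rel V) (l : nat)
    (B F : {set V}) :
    l <= #|V| -> leaky_psd_forcing e l B ->
    F != set0 -> connected_set e F -> #|boundary1 e F| <= l ->
  B :&: F != set0.
Proof.
move=> lV /forallP Bforc F0 Fconn Fl; apply: contra F0 => BF.
have [|L FL Ll] := @superset_of_card V (boundary1 e F) l; first by rewrite Fl.
have FB : F \subset ~: B by rewrite -disjoints_subset disjoint_sym -setI_eq0.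
move/implyP: (Bforc L); rewrite Ll eqxx => /(_ isT) /connectP[p].
(* Along the sequence of forces [F] stays white, whereas the last blue set is all of [V]; hence [F]
   is empty. *)
elim: p B FB {BF Bforc} => [|B' p IHp] B FB /=.
  by move=> _ BT; rewrite -subset0 -setCT BT.
by case/andP=> BB'; apply: IHp (psd_step_avoids Fconn FL BB' FB).
Qed.

Lemma hits_psd_step (V : finType) (e : rel V) (L B : {set V}) :
    symmetric e -> B != [set: V] ->
    (forall F : {set V}, F != set0 -> connected_set e F ->
       #|boundary1 e F| <= #|L| -> B :&: F != set0) ->
  exists2 y, y \notin B & psd_step e L B (y |: B).
Proof.
move=> e_sym BT hitB.
have [x0 x0B] : exists x0, x0 \in ~: B.
  by apply/set0Pn; apply: contra BT => /eqP BC; rewrite -(setCK B) BC setC0.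
pose C := [set y | connect (induced e (~: B)) x0 y].
have CB y : y \in C -> y \notin B.
  by rewrite inE => /(connect_induced_mem x0B); rewrite inE.
(* Otherwise the boundary of [C] has at most [#|L|] elements, and [B] would have to meet the white
   set [C]. *)
have [x xC xL] : exists2 x, x \in boundary1 e C & x \notin L.
  apply/subsetPn/negP => /subset_leq_card CL.
  have C0 : C != set0 by apply/set0Pn; exists x0; rewrite inE connect0.
  have /set0Pn[y /setIP[yB yC]] := hitB C C0 (component_connected _ _ e_sym) CL.
  by move: (CB y yC); rewrite yB.
move: xC; rewrite !inE => /andP[xC /cards1P[y NC]].
have : y \in nbrs e x :&: C by rewrite NC set11.
case/setIP; rewrite inE => exy yC; have yB := CB y yC.
(* A white [x] adjacent to [y] would belong to the component [C], but boundary vertices lie outside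
   [C]. *)
have xB : x \in B.
  apply: contraR xC => xB; move: yC; rewrite inE => /connect_trans; apply.
  by apply: connect1; rewrite /induced /= !inE yB xB e_sym.
exists y => //; apply/existsP; exists x; apply/existsP; exists y.
rewrite xL eqxx andbT /psd_force xB /=; apply/existsP; exists C.
by rewrite NC eqxx andbT imset_f.
Qed.

Lemma hits_leaky_psd_forcing (V : finType) (e : rel V) (l : nat) (B : {set V}) :
    symmetric e ->
    (forall F : {set V}, F != set0 -> connected_set e F ->
       #|boundary1 e F| <= l -> B :&: F != set0) ->
  leaky_psd_forcing e l B.
Proof.
move=> e_sym hitB; apply/forallP => L; apply/implyP => /eqP Ll.
rewrite -{}Ll in hitB.
(* Induction on the number of white vertices: each force lowers it, and a larger blue set still
   meets every [F]. *)
have [n] := ubnP #|~: B|; elim: n B hitB => // n IHn B hitB Bn.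
have [-> | BT] := eqVneq B [set: V]; first exact: connect0.
have [y yB step] := hits_psd_step e_sym BT hitB.
apply: connect_trans (connect1 step) (IHn _ _ _) => [F F0 Fconn Fl|].
  by rewrite setIUl setU_eq0 negb_and hitB ?orbT.
rewrite -ltnS; apply: leq_trans Bn; rewrite ltnS; apply: proper_card.
by rewrite properC properUr // sub1set.
Qed.

(** The two minimisers may be different sets, so their sizes are compared in both directions. [P
    [set: V]] makes the default of each [arg min] admissible. *)
Lemma eq_min_size (V : finType) (P Q : pred {set V}) :
  P =1 Q -> P [set: V] -> min_size P = min_size Q.
Proof.
move=> PQ PT; rewrite /min_size.
case: arg_minnP => // A PA minA; case: arg_minnP => [|B QB minB].
  by rewrite -PQ.
by apply/eqP; rewrite eqn_leq minA ?minB ?PQ // -PQ.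
Qed.

Theorem theorem8 (V : finType) (e : rel V)
    (e_sym : symmetric e) (e_irr : irreflexive e)
    (l : nat) (l_le : l <= #|V|) :
  (forall B : {set V},
     leaky_psd_forcing e l B <->
     (forall F : {set V},
        F != set0 -> connected_set e F -> #|boundary1 e F| <= l ->
        B :&: F != set0))
  /\ leaky_psd_number e l = hitting_number (forts e l).
Proof.
have forcingP (B : {set V}) : leaky_psd_forcing e l B <->
    (forall F : {set V}, F != set0 -> connected_set e F ->
       #|boundary1 e F| <= l -> B :&: F != set0).
  split=> [Bforc F|]; first exact: leaky_psd_forcing_hits.
  exact: hits_leaky_psd_forcing.
split=> //; apply: eq_min_size; last exact: leaky_psd_forcingT.
move=> B; apply/idP/forallP => [/forcingP hitB F | hitB].
  by apply/implyP; rewrite inE => /and3P[]; apply: hitB.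
apply/forcingP => F F0 Fconn Fl.
by move/implyP: (hitB F); apply; rewrite inE F0 Fconn.
Qed.
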